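(* Let a sender $s$ with transmission power $P_{Ts}>0$ send a packet to its candidate forwarding set $R_{P_{Ts}}(s)$, consisting of $n_{rel}\ge1$ nodes, and let $P_{si}$, $1\le i\le n_{rel}$, be the probability that the $i$-th node of this set receives a given transmission of the packet from $s$ successfully, in the interference and Rayleigh fading model described in the context. Then the one-hop expected energy cost $\mathbb{C}_s(P_{Ts},n_{rel})$ incurred by $s$ in sending a packet to the nodes in $R_{P_{Ts}}(s)$ is $$\mathbb{C}_s(P_{Ts},n_{rel})=\frac{(n_{rel}E_r+\xi P_{Ts})\,\delta}{\left(1-\prod_{i=1}^{n_{rel}}(1-P_{si})\right)^2},\qquad \delta=\frac{L}{B}.$$
   Context: Positive constants: $L$ is the data packet size, $B$ the bandwidth, $E_r$ the energy consumption for reception, $\xi$ the consumption coefficient for data packet transmission; the energy consumption for transmission with power $P_{Ts}$ is $E_{P_{Ts}}=\xi P_{Ts}$. Reception probabilities: for the $i$-th node $r_i$ of the candidate forwarding set, at distance $d_{r_is}>0$ from $s$ and with $m_i\ge 0$ interference nodes having transmission powers $P^{(i)}_{Tk}>0$ and distances $d_{r_ik}>0$ to $r_i$ ($1\le k\le m_i$), $$P_{si}=\exp\left[-\frac{\beta P_n d_{r_is}^{\eta}}{P_{Ts}K}\right]\prod_{k=1}^{m_i}\frac{1}{1+\frac{\beta P^{(i)}_{Tk}}{G P_{Ts}(d_{r_ik}/d_{r_is})^{\eta}}},$$ where $\beta$ (SINR threshold), $P_n$ (noise power), $\eta$ (propagation loss coefficient, $2\le\eta\le5$), $K$ (antenna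 gain), $G$ (processing gain) are positive constants. The probability that at least one node of the candidate forwarding set receives a given transmission is $P_{sc}(P_{Ts},n_{rel})=1-\prod_{i=1}^{n_{rel}}(1-P_{si})$. Number of attempts: $T_{P_{Ts}}(s)$ is the number of transmission attempts until the packet is received by at least one node of the candidate forwarding set; its distribution is $\Pr\{T_{P_{Ts}}(s)=l\}=\left(\prod_{i=1}^{n_{rel}}(1-P_{si})\right)^{l-1}\left(1-\prod_{i=1}^{n_{rel}}(1-P_{si})\right)$ for $l=1,2,\dots$, and $E\{T_{P_{Ts}}(s)\}$ denotes its expectation. Energy cost: the energy needed for packet transmission and reception from the sender to the candidate forwarding set is $$E_s=\left(|R_{P_{Ts}}(s)|\,E_r+E_{P_{Ts}}\right)\cdot E\{T_{P_{Ts}}(s)\}\cdot\frac{L}{B},$$ and the one-hop expected energy cost is defined as $\mathbb{C}_s(P_{Ts},n_{rel})=\dfrac{E_s}{P_{sc}(P_{Ts},n_{rel})}$. *)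

(* Defs.v *)
From HB Require Import structures.
From mathcomp Require Import all_boot all_order all_algebra finmap.
From mathcomp Require Import all_classical all_reals all_analysis.

Set Implicit Arguments.
Unset Strict Implicit.
Unset Printing Implicit Defensive.

Import Order.TTheory GRing.Theory Num.Theory.
Local Open Scope ring_scope.

(* [rx_prob] is the probability that a node at distance [ds] from the sender
   receives a transmission of power [PTs], when [m] interferers of powers
   [PT k] are at distances [dI k] from that node: Rayleigh fading, SINR
   threshold [beta], noise power [Pn], propagation loss exponent [eta],
   antenna gain [K], processing gain [G]. *)
Definition rx_prob (R : realType) (beta Pn eta K G PTs ds : R)
    (m : nat) (PT dI : 'I_m -> R) : R :=
  expR (- (beta * Pn * ds `^ eta / (PTs * K))) *
  \prod_(k < m) (1 / (1 + beta * PT k / (G * PTs * (dI k / ds) `^ eta))).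

(* [fail_prob p] is the probability that no candidate receives a transmission,
   [set_rx_prob p] that at least one does; candidate [i] succeeds with
   probability [p i]. *)
Definition fail_prob (R : realType) (n : nat) (p : 'I_n -> R) : R :=
  \prod_(i < n) (1 - p i).

Definition set_rx_prob (R : realType) (n : nat) (p : 'I_n -> R) : R :=
  1 - fail_prob p.

(* Law of the number of attempts [N] until some candidate receives the packet.
   The masses over l >= 1 are prescribed, as in the model; nothing is required
   separately at 0. *)
Definition attempts_law (R : realType) (d : measure_display)
    (Omega : measurableType d) (P : probability Omega R)
    (n : nat) (p : 'I_n -> R) (N : Omega -> nat) : Prop :=
  forall l : nat, (1 <= l)%N ->
    P (N @^-1` [set l])%classic
    = (fail_prob p ^+ (l - 1)%N * (1 - fail_prob p))%:E.

Definition expected_attempts (R : realType) (d : measure_display)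
    (Omega : measurableType d) (P : probability Omega R)
    (N : Omega -> nat) : \bar R :=
  'E_P[(fun w => (N w)%:R : R)].

Definition tx_energy (R : realType) (xi PTs : R) : R := xi * PTs.

(* E_s, for a candidate set with [card] nodes and [ET] expected attempts; it is
   extended-real valued because [ET] is. *)
Definition sender_energy (R : realType) (card : nat) (Er xi PTs L B : R)
    (ET : \bar R) : \bar R :=
  ((card%:R * Er + tx_energy xi PTs)%:E * ET * (L / B)%:E)%E.

Definition energy_cost (R : realType) (Es : \bar R) (Psc : R) : \bar R :=
  (Es / Psc%:E)%E.

(* Main.v *)
Require Import Defs.
From HB Require Import structures.
From mathcomp Require Import all_boot all_order all_algebra finmap.
From mathcomp Require Import all_classical all_reals all_analysis.
From mathcomp Require Import ring.

(** The failure probability [q] of one transmission lies in [0, 1), because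
    every [rx_prob] is positive. Countable additivity over the prescribed masses
    gives P(T > k) = q ^ k, also for k = 0; hence
    E[T] = sum_k P(T > k) = 1 / (1 - q). *)

Set Implicit Arguments.
Unset Strict Implicit.
Unset Printing Implicit Defensive.

Import Order.TTheory GRing.Theory Num.Theory.
Local Open Scope ring_scope.

Lemma nneseries_geometric (R : realType) (a q : R) : 0 <= q -> q < 1 ->
  (\sum_(k <oo) (a * q ^+ k)%:E)%E = (a / (1 - q))%:E.
Proof.
move=> q0 q1; have nq1 : `|q| < 1 by rewrite ger0_norm.
apply: cvg_lim => //.
under eq_fun do rewrite sumEFin.
apply: cvg_EFin; first exact: nearW.
exact: cvg_geometric_series.
Qed.

(** Layer-cake form of a natural number: the terms are 1 up to index [n - 1] and 0 from [n] on. It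
    turns [N w] into a series of indicators. *)
Lemma nneseries_ltn (R : realType) (n : nat) :
  (\sum_(k <oo) ((k < n)%N%:R : R)%:E)%E = (n%:R)%:E.
Proof.
rewrite (nneseries_split 0 n) ?add0n; last by move=> k _; rewrite lee_fin.
rewrite eseries0 ?adde0; last by move=> k nk _; rewrite ltnNge nk.
rewrite sumEFin big_mkord (eq_bigr (fun=> 1)) ?sumr_const ?card_ord //.
by move=> k _; rewrite ltn_ord.
Qed.

Lemma fail_prob_ge0_lt1 (R : realType) (n : nat) (p : 'I_n -> R) :
  (0 < n)%N -> (forall i, 0 < p i <= 1) -> 0 <= fail_prob p < 1.
Proof.
case: n p => // n p _ p01.
have f01 i : 0 <= 1 - p i <= 1.
  by have /andP[p0 p1] := p01 i; rewrite subr_ge0 p1 gerBl ltW.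
apply/andP; split; first by apply: prodr_ge0 => i _; case/andP: (f01 i).
(* One candidate suffices for strictness: its factor is below 1, and the remaining factors, all in
   [0, 1], cannot increase the product. *)
rewrite /fail_prob big_ord_recl; apply: (@le_lt_trans _ _ (1 - p ord0)).
  by rewrite ler_piMr ?prodr_ile1// subr_ge0; case/andP: (p01 ord0).
by rewrite gtrBl; case/andP: (p01 ord0).
Qed.

(** The exponent is nonpositive and each interference denominator exceeds 1, so every factor lies in
    (0, 1]. *)
Lemma rx_prob_gt0_le1 (R : realType) (beta Pn eta K G PTs ds : R)
    (m : nat) (PT dI : 'I_m -> R) :
  0 < beta -> 0 < Pn -> 0 < K -> 0 < G -> 0 < PTs -> 0 < ds ->
  (forall k, 0 < PT k) -> (forall k, 0 < dI k) ->
  0 < rx_prob beta Pn eta K G PTs ds PT dI <= 1.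
Proof.
move=> b0 Pn0 K0 G0 PTs0 ds0 PT0 dI0.
have c0 k : 0 < beta * PT k / (G * PTs * (dI k / ds) `^ eta).
  by rewrite divr_gt0 ?mulr_gt0 ?powR_gt0 ?divr_gt0.
have f01 k : 0 < 1 / (1 + beta * PT k / (G * PTs * (dI k / ds) `^ eta)) <= 1.
  by rewrite divr_gt0 ?addr_gt0//= div1r invf_le1 ?addr_gt0// lerDl ltW.
rewrite /rx_prob mulr_gt0 ?expR_gt0 ?prodr_gt0//=; last first.
  by move=> k _; case/andP: (f01 k).
apply: mulr_ile1; rewrite ?expR_ge0//.
- by apply: prodr_ge0 => k _; case/andP: (f01 k) => /ltW.
- by rewrite expR_le1 oppr_le0 divr_ge0 ?mulr_ge0 ?powR_ge0 ?ltW.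
- by apply: prodr_ile1 => k _; case/andP: (f01 k) => /ltW -> ->.
Qed.

Section nat_random_variable.
Context (R : realType) (d : measure_display) (Omega : measurableType d).
Context (P : probability Omega R) (N : {RV P >-> nat}).

Lemma measurable_RV_nat (A : set nat) : measurable (N @^-1` A)%classic.
Proof. by rewrite -[X in measurable X]setTI; exact: measurable_funP. Qed.

Lemma ltn_RV_indic (k : nat) (w : Omega) :
  (k < N w)%N%:R = \1_(N @^-1` [set l | (k < l)%N])%classic w :> R.
Proof.
by rewrite indicE; congr (nat_of_bool _)%:R; apply/idP/idP; rewrite inE.
Qed.

(** Tonelli: [N] is expanded into the indicators of the events [k < N], and the nonnegative series
    is integrated term by term. *)
Lemma expectation_tail_sum :
  ('E_P[(fun w => (N w)%:R : R)] =
   \sum_(k <oo) P (N @^-1` [set l | (k < l)%N])%classic)%E.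
Proof.
rewrite unlock; under eq_integral do rewrite -nneseries_ltn.
rewrite integral_nneseries//; last first.
  move=> k; under eq_fun do rewrite ltn_RV_indic.
  apply/measurable_realfun.measurable_EFinP.
  exact/measurable_realfun.measurable_indic/measurable_RV_nat.
apply: eq_eseriesr => k _.
under eq_integral do rewrite ltn_RV_indic.
by rewrite integral_indic ?setIT//; exact: measurable_RV_nat.
Qed.

Lemma tail_prob_geometric (q : R) (k : nat) : 0 <= q -> q < 1 ->
  (forall l, (0 < l)%N ->
    P (N @^-1` [set l])%classic = (q ^+ (l - 1)%N * (1 - q))%:E) ->
  P (N @^-1` [set l | (k < l)%N])%classic = (q ^+ k)%:E.
Proof.
move=> q0 q1 Nq.
(* The tail event is cut into disjoint fibres. The shift by [k.+1] keeps every value at least 1, so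
   only prescribed masses occur, even for [k = 0]. *)
have -> : (N @^-1` [set l | (k < l)%N] =
    \bigcup_j N @^-1` [set (j + k.+1)%N])%classic.
  apply/seteqP; split=> [w /= kN|w [j _ /= ->]]; last by rewrite leq_addl.
  by exists (N w - k.+1)%N => //=; rewrite subnK.
rewrite measure_semi_bigcup; last 3 first.
- by move=> j; exact: measurable_RV_nat.
- by move=> i j _ _ [w [/= -> /eqP]]; rewrite eqn_add2r => /eqP.
- by apply: bigcup_measurable => j _; exact: measurable_RV_nat.
(* The fibre over [j + k.+1] has mass [q ^+ (j + k) * (1 - q)]; the factor [1 - q] cancels against
   the sum of the geometric series. *)
transitivity (\sum_(j <oo) ((q ^+ k * (1 - q)) * q ^+ j)%:E)%E.
  apply: eq_eseriesr => j _; apply: etrans (Nq _ _) _; first by rewrite addnS.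
  by rewrite addnS subn1 /= exprD -mulrA mulrC.
by rewrite nneseries_geometric// mulfK// subr_eq0 gt_eqF.
Qed.

Lemma expectation_geometric (q : R) : 0 <= q -> q < 1 ->
  (forall l, (0 < l)%N ->
    P (N @^-1` [set l])%classic = (q ^+ (l - 1)%N * (1 - q))%:E) ->
  ('E_P[(fun w => (N w)%:R : R)] = (1 - q)^-1%:E)%E.
Proof.
move=> q0 q1 Nq; rewrite expectation_tail_sum.
under eq_eseriesr do rewrite (tail_prob_geometric _ q0 q1 Nq) -[_ ^+ _]mul1r.
by rewrite nneseries_geometric// div1r.
Qed.

End nat_random_variable.

Theorem corollary3 (R : realType)
    (* positive constants of the model *)
    (L B Er xi beta Pn eta K G : R)
    (L_gt0 : 0 < L) (B_gt0 : 0 < B) (Er_gt0 : 0 < Er) (xi_gt0 : 0 < xi)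
    (beta_gt0 : 0 < beta) (Pn_gt0 : 0 < Pn) (eta_ge2 : 2 <= eta)
    (eta_le5 : eta <= 5) (K_gt0 : 0 < K) (G_gt0 : 0 < G)
    (* sender, its power, its candidate forwarding set {r_1, .., r_nrel} *)
    (V : choiceType) (s : V) (PTs : R) (PTs_gt0 : 0 < PTs)
    (nrel : nat) (nrel_ge1 : (1 <= nrel)%N)
    (Rset : {fset V}) (Rset_card : #|` Rset | = nrel)
    (r : 'I_nrel -> V) (Rset_enum : forall v : V,
       v \in Rset <-> exists i : 'I_nrel, r i = v)
    (* distances, interference nodes and their powers *)
    (dist : V -> V -> R) (dist_s_gt0 : forall i, 0 < dist (r i) s)
    (m : 'I_nrel -> nat) (itf : forall i : 'I_nrel, 'I_(m i) -> V)
    (PT : forall i : 'I_nrel, 'I_(m i) -> R)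
    (PT_gt0 : forall i (k : 'I_(m i)), 0 < PT i k)
    (dist_itf_gt0 : forall i (k : 'I_(m i)), 0 < dist (r i) (itf i k))
    (* reception probabilities *)
    (Psi : 'I_nrel -> R)
    (Psi_def : forall i, Psi i =
       rx_prob beta Pn eta K G PTs (dist (r i) s)
         (PT i) (fun k => dist (r i) (itf i k)))
    (* number of attempts *)
    (d : measure_display) (Omega : measurableType d)
    (P : probability Omega R) (T : {RV P >-> nat})
    (T_law : attempts_law P Psi T) :
  energy_cost
    (sender_energy #|` Rset | Er xi PTs L B (expected_attempts P T))
    (set_rx_prob Psi)
  = (let delta := L / B in
     (nrel%:R * Er + xi * PTs) * delta
       / (1 - \prod_(i < nrel) (1 - Psi i)) ^+ 2)%:E.
Proof.
have /andP[q0 q1] : 0 <= fail_prob Psi < 1.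
  apply: fail_prob_ge0_lt1 => // i.
  by rewrite Psi_def; exact: rx_prob_gt0_le1.
have q1' : 1 - fail_prob Psi != 0 by rewrite subr_eq0 gt_eqF.
rewrite /energy_cost /sender_energy /expected_attempts /set_rx_prob.
rewrite (expectation_geometric q0 q1 T_law) Rset_card /tx_energy.
rewrite -/(fail_prob Psi).
(* The extended-real inverse treats 0 separately; [q1'] selects the finite branch, so the identity
   descends to the reals. *)
rewrite inver (negbTE q1') -!EFinM; congr _%:E => /=.
(* The square combines one inverse from the expected number of attempts and one from the division by
   [set_rx_prob]. *)
by rewrite expr2 invfM; ring.
Qed.
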